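(* Let $X$ be a finite set and $\theta:[t_1,\infty)\to\Pi_X$ a sequence of partitions of $X$ with change points $t_1<\dots<t_M$. The bifiltrations $\mathcal M=(K^{s,t})_{t_1\le s\le t}$ (the MCbiF) and $\tilde{\mathcal M}=(\tilde K^{s,t})_{t_1\le s\le t}$ (the nerve-based MCbiF) lead to the same persistence module, i.e. for every $k\ge0$ the persistence modules $(s,t)\mapsto H_k(K^{s,t})$ and $(s,t)\mapsto H_k(\tilde K^{s,t})$ are isomorphic.
   Context: $X$ is a finite set and $\Pi_X$ is the set of partitions of $X$ (into nonempty clusters); $\theta(t)_i$ denotes the $i$-th cluster of $\theta(t)$ (for a fixed enumeration). A sequence of partitions is a piecewise-constant map $\theta:[t_1,\infty)\to\Pi_X$ with change points $t_1<\dots<t_M$: $\theta(t)=\theta(t_m)$ for $t\in[t_m,t_{m+1})$, $1\le m\le M-1$, and $\theta(t)=\theta(t_M)$ for $t\ge t_M$. MCbiF: for $t_1\le s\le t$, $K^{s,t}:=\bigcup_{s\le r\le t}\bigcup_{C\in\theta(r)}\Delta C$, where $\Delta C:=2^C$ is the solid simplex on $C$. Nerve-based MCbiF: let $V_m:=\{(m,i): 1\le i\le|\theta(t_m)|\}$ and $A(\ell,m):=V_\ell\uplus\dots\uplus V_m$ for $1\le\ell\le m\le M$. With the convention $t_{M+1}=\infty$, for $s\in[t_\ell,t_{\ell+1})$ and $t\in[t_m,t_{m+1})$ with $s\le t$, put $$\tilde K^{s,t}:=\{\sigma\subseteq A(\ell,m): \sigma\ne\emptyset,\ \bigcap_{(n,i)\in\sigma}\theta(t_n)_i\ne\emptyset\}.$$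 Both families are bifiltrations: $K^{s,t}\subseteq K^{s',t'}$ and $\tilde K^{s,t}\subseteq\tilde K^{s',t'}$ if $s\ge s'$ and $t\le t'$. $H_k$ is simplicial homology with coefficients in a fixed field, and the maps of the persistence modules are induced by the inclusions, over the poset $\{(s,t):t_1\le s\le t\}$ with $(s,t)\le(s',t')$ iff $s\ge s'$, $t\le t'$. *)

(* Defs.v *)
From HB Require Import structures.
From mathcomp Require Import all_boot all_order all_algebra.
From mathcomp Require Import generic_quotient ring_quotient.
From mathcomp Require Import boolp reals.

Set Implicit Arguments.
Unset Strict Implicit.
Unset Printing Implicit Defensive.

Import Order.TTheory GRing.Theory Num.Theory.
Local Open Scope ring_scope.
Local Open Scope quotient_scope.

(* Mathcomp only equips {quot U} with a Z-module structure. *)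
Section QuotientSpace.
Variables (F : fieldType) (vT : vectType F) (U : {vspace vT}).

Definition quot_space := Quotient.quot (pred_of_vspace U).

HB.instance Definition _ := GRing.Zmodule.on quot_space.
HB.instance Definition _ :=
  EqQuotient.copy quot_space (Quotient.quot (pred_of_vspace U)).

Definition class_of (x : vT) : quot_space := \pi_quot_space x.

Definition quot_repr (x : quot_space) : vT := repr x.

Lemma quot_reprK x : class_of (quot_repr x) = x.
Proof. exact: reprK. Qed.

Lemma class_ofP x y : reflect (class_of x = class_of y) (x - y \in U).
Proof. by rewrite (Quotient.idealrBE (pred_of_vspace U)); apply: eqP. Qed.

Lemma class_ofD x y : class_of (x + y) = class_of x + class_of y.
Proof. exact: (Quotient.pi_add (pred_of_vspace U)). Qed.

Definition quot_scale (a : F) (x : quot_space) : quot_space :=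
  class_of (a *: quot_repr x).

Lemma class_ofZ a x : class_of (a *: x) = quot_scale a (class_of x).
Proof.
apply/class_ofP; rewrite -scalerBr rpredZ //.
by apply/class_ofP; rewrite quot_reprK.
Qed.

Fact quot_scaleA a b x :
  quot_scale a (quot_scale b x) = quot_scale (a * b) x.
Proof. by rewrite -[x]quot_reprK -!class_ofZ scalerA. Qed.

Fact quot_scale1 : left_id 1 quot_scale.
Proof. by move=> x; rewrite -[x]quot_reprK -class_ofZ scale1r. Qed.

Fact quot_scaleDr : right_distributive quot_scale +%R.
Proof.
move=> a x y; rewrite -[x]quot_reprK -[y]quot_reprK.
by rewrite -class_ofD -!class_ofZ scalerDr class_ofD.
Qed.

Fact quot_scaleDl x : {morph quot_scale^~ x : a b / a + b}.
Proof.
by move=> a b; rewrite -[x]quot_reprK -!class_ofZ scalerDl class_ofD.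
Qed.

HB.instance Definition _ := GRing.Zmodule_isLmodule.Build F quot_space
  quot_scaleA quot_scale1 quot_scaleDr quot_scaleDl.

Fact class_of_linear : linear class_of.
Proof. by move=> a x y; rewrite class_ofD class_ofZ. Qed.

HB.instance Definition _ :=
  GRing.isLinear.Build F vT quot_space _ class_of class_of_linear.

End QuotientSpace.

(* Whether the empty set belongs to [simplices] is left free: [chains] below
   start from sets of cardinality 1. *)
Record complex (V : finType) := Complex {
  simplices :> {set {set V}};
  simplices_closed : forall s t : {set V},
    s \in simplices -> t \subset s -> t != set0 -> t \in simplices
}.

(* Non-augmented simplicial homology with coefficients in [F]; simplices are
   oriented by the enumeration order of [V]. *)
Section Homology.
Variables (F : fieldType) (V : finType).
Implicit Types (K L : complex V) (s t : {set V}) (k : nat).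

Definition chain := {ffun {set V} -> F^o}.
HB.instance Definition _ := Vector.on chain.

Definition elem_chain s : chain := [ffun t => (t == s)%:R].

(* Sign exponent of the face opposite to [v] in [s]. *)
Definition vertex_pos s (v : V) : nat :=
  #|[set w in s | (enum_rank w < enum_rank v)%N]|.

(* The side condition makes the boundary of a vertex zero. *)
Definition face_sum s : chain :=
  \sum_(v in s | s :\ v != set0) (-1) ^+ vertex_pos s v *: elem_chain (s :\ v).

Definition boundary_fun (c : chain) : chain := \sum_s c s *: face_sum s.

Fact boundary_fun_linear : linear boundary_fun.
Proof.
move=> a c d; rewrite /boundary_fun scaler_sumr -big_split /=.
by apply: eq_bigr => s _; rewrite !ffunE scalerDl scalerA.
Qed.

HB.instance Definition _ :=
  GRing.isLinear.Build F chain chain _ boundary_fun boundary_fun_linear.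

Definition boundary : 'End(chain) := linfun boundary_fun.

Definition chains K k : {vspace chain} :=
  <<[seq elem_chain s | s <- enum K & #|s| == k.+1]>>%VS.

Definition cycles K k : {vspace chain} := (chains K k :&: lker boundary)%VS.

Definition boundaries K k : {vspace chain} := (boundary @: chains K k.+1)%VS.

Lemma boundary_elem s : boundary_fun (elem_chain s) = face_sum s.
Proof.
rewrite /boundary_fun (bigD1 s) //= ffunE eqxx scale1r big1 ?addr0 // => t ts.
by rewrite ffunE (negPf ts) scale0r.
Qed.

Lemma vertex_pos_del s v w : v \in s ->
  vertex_pos s w = ((enum_rank v < enum_rank w) + vertex_pos (s :\ v) w)%N.
Proof.
move=> vs; rewrite /vertex_pos (cardsD1 v) !inE vs /=; congr (_ + _)%N.
by apply: eq_card => u; rewrite !inE andbA.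
Qed.

Lemma boundary_face_sum s : boundary_fun (face_sum s) = 0.
Proof.
pose T v w : chain := (-1) ^+ (vertex_pos s v + vertex_pos (s :\ v) w)%N
   *: elem_chain (s :\ v :\ w).
pose P v w := [&& v \in s, w \in s & s :\ v :\ w != set0].
have -> : boundary_fun (face_sum s) =
   \sum_v \sum_(w | P v w && (enum_rank v < enum_rank w)%N) (T v w + T w v).
  rewrite /face_sum linear_sum /=.
  have -> : \sum_(v in s | s :\ v != set0) boundary_fun
       ((-1) ^+ vertex_pos s v *: elem_chain (s :\ v)) =
     \sum_v \sum_(w | P v w && (w != v)) T v w.
    rewrite big_mkcond /=; apply: eq_bigr => v _.
    case: ifP => [/andP[vs _]|vs].
      rewrite linearZ /= boundary_elem scaler_sumr; apply: eq_big => [w|w _].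
        by rewrite /P !inE vs /=; do !case: (_ \in _); do !case: (_ == _).
      by rewrite scalerA -exprD.
    rewrite big_pred0 // => w; apply/negP => /andP[/and3P[v_s ws /set0Pn[x xI]]] _; move: xI.
    rewrite !inE => /and3P[xw xv xs]; move: vs; rewrite v_s /=.
    by move=> /negbT/negP[]; apply/set0Pn; exists x; rewrite !inE xv.
  under [LHS]eq_bigr => v _ do rewrite (bigID (fun w => (enum_rank v < enum_rank w)%N)) /=.
  rewrite [LHS]big_split /=.
  under [RHS]eq_bigr => v _ do rewrite big_split /=.
  rewrite [RHS]big_split /=; congr (_ + _).
    apply: eq_bigr => v _; apply: eq_bigl => w.
    by case: (w =P v) => [->|_]; rewrite ?ltnn ?andbF ?andbT.
  rewrite (exchange_big_dep xpredT) //=; apply: eq_bigr => v _; apply: eq_bigl => w.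
  rewrite /P -leqNgt ltn_neqAle (inj_eq val_inj) (inj_eq enum_rank_inj).
  by rewrite setDDl setUC -setDDl eq_sym -!andbA; do !bool_congr.
rewrite big1 // => v _; rewrite big1 // => w /andP[/and3P[vs ws _] vw].
rewrite /T (vertex_pos_del w vs) (vertex_pos_del v ws) vw.
rewrite [(enum_rank w < _)%N]ltnNge (ltnW vw) /= add0n add1n addSn exprS mulN1r.
by rewrite scaleNr addnC !setDDl [[set w] :|: _]setUC addrN.
Qed.

Lemma face_sum_chains K k s : s \in simplices K -> #|s| = k.+2 ->
  face_sum s \in chains K k.
Proof.
move=> sK sk; apply: rpred_sum => v /andP[vs s0]; apply: rpredZ.
apply/memv_span/map_f; rewrite mem_filter mem_enum.
rewrite (simplices_closed sK _ s0) ?subD1set // andbT.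
by move: sk; rewrite (cardsD1 v) vs add1n => -[->].
Qed.

Lemma boundaries_sub K k : (boundaries K k <= cycles K k)%VS.
Proof.
rewrite /boundaries /chains limg_span; apply/span_subvP => c.
case/mapP => b /mapP[s]; rewrite mem_filter mem_enum => /andP[/eqP sk sK] -> ->.
rewrite lfunE /= boundary_elem memv_cap face_sum_chains //=.
by rewrite memv_ker lfunE /= boundary_face_sum.
Qed.

Definition boundaries_in_cycles K k : {vspace subvs_of (cycles K k)} :=
  (linfun (@vsval F chain (cycles K k)) @^-1: boundaries K k)%VS.

Definition homology K k : lmodType F := quot_space (boundaries_in_cycles K k).

Lemma chainsS K L k : K \subset L -> (chains K k <= chains L k)%VS.
Proof.
move=> KL; apply: sub_span => c /mapP[s].
rewrite mem_filter mem_enum => /andP[sk sK] ->.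
by apply: map_f; rewrite mem_filter mem_enum sk (subsetP KL).
Qed.

Lemma cyclesS K L k : K \subset L -> (cycles K k <= cycles L k)%VS.
Proof. by move=> KL; apply: capvS => //; apply: chainsS. Qed.

Lemma boundariesS K L k : K \subset L -> (boundaries K k <= boundaries L k)%VS.
Proof. by move=> KL; apply: limgS; apply: chainsS. Qed.

Section Induced.
Variables (K L : complex V) (k : nat).

Definition cycles_incl (KL : K \subset L) (z : subvs_of (cycles K k)) :
  subvs_of (cycles L k) := vsproj (cycles L k) (vsval z).

Lemma val_cycles_incl (KL : K \subset L) z :
  vsval (cycles_incl KL z) = vsval z.
Proof. by rewrite vsprojK // (subvP (cyclesS k KL)) ?subvsP. Qed.

Definition homology_map (KL : K \subset L) (x : homology K k) : homology L k :=
  class_of _ (cycles_incl KL (quot_repr x)).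

Lemma homology_map_class (KL : K \subset L) z :
  homology_map KL (class_of _ z) = class_of _ (cycles_incl KL z).
Proof.
apply/class_ofP; rewrite -memv_preim lfunE /= !val_cycles_incl.
apply: (subvP (boundariesS k KL)).
have : quot_repr (class_of (boundaries_in_cycles K k) z) - z
         \in boundaries_in_cycles K k by apply/class_ofP; rewrite quot_reprK.
by rewrite -memv_preim lfunE.
Qed.

Fact homology_map_linear (KL : K \subset L) : linear (homology_map KL).
Proof.
move=> a x y; rewrite -[x]quot_reprK -[y]quot_reprK -linearP.
by rewrite !homology_map_class /cycles_incl !linearP.
Qed.

HB.instance Definition _ (KL : K \subset L) :=
  GRing.isLinear.Build F (homology K k) (homology L k) _ (homology_map KL)
    (homology_map_linear KL).

End Induced.

Lemma homology_map_id K k (KK : K \subset K) (x : homology K k) :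
  homology_map KK x = x.
Proof.
rewrite -[x]quot_reprK homology_map_class; congr (class_of _ _).
by apply: val_inj; apply: val_cycles_incl.
Qed.

Lemma homology_map_comp K1 K2 K3 k (K12 : K1 \subset K2) (K23 : K2 \subset K3)
    (K13 : K1 \subset K3) (x : homology K1 k) :
  homology_map K13 x = homology_map K23 (homology_map K12 x).
Proof.
rewrite -[x]quot_reprK !homology_map_class; congr (class_of _ _).
by apply: val_inj; rewrite /= !val_cycles_incl.
Qed.

End Homology.

Section Persistence.
Variables (F : fieldType) (d : Order.disp_t) (P : porderType d).
Local Open Scope order_scope.

Record persmod := Persmod {
  pm_space :> P -> lmodType F;
  pm_map : forall p q : P, p <= q -> {linear pm_space p -> pm_space q};
  pm_map_id : forall p (pp : p <= p) (x : pm_space p), pm_map pp x = x;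
  pm_map_comp : forall p q r (pq : p <= q) (qr : q <= r) (pr : p <= r)
    (x : pm_space p), pm_map pr x = pm_map qr (pm_map pq x)
}.

Definition persmod_iso (M N : persmod) : Prop :=
  exists f : forall p, {linear M p -> N p},
    (forall p, bijective (f p)) /\
    (forall p q (pq : p <= q) (x : M p),
       f q (pm_map M pq x) = pm_map N pq (f p x)).

Record filtration (V : finType) := Filtration {
  fil :> P -> complex V;
  filS : forall p q : P, p <= q -> fil p \subset fil q
}.

Definition homology_persmod (V : finType) (K : filtration V) (k : nat) :
    persmod :=
  @Persmod (fun p => homology F (K p) k)
    (fun p q pq => homology_map (filS K pq))
    (fun p pp x => homology_map_id (filS K pp) x)
    (fun p q r pq qr pr x =>
       homology_map_comp (filS K pq) (filS K qr) (filS K pr) x).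

End Persistence.

(* The order is reversed on starting times. *)
Section Bitime.
Variables (R : realType) (t1 : R).

Definition bitime := {p : R * R | t1 <= p.1 <= p.2}.

HB.instance Definition _ := Choice.on bitime.

Definition btstart (p : bitime) : R := (val p).1.
Definition btend (p : bitime) : R := (val p).2.

Definition bitime_le (p q : bitime) : bool :=
  (btstart q <= btstart p) && (btend p <= btend q).

Fact bitime_le_refl : reflexive bitime_le.
Proof. by move=> p; rewrite /bitime_le !lexx. Qed.

Fact bitime_le_anti : antisymmetric bitime_le.
Proof.
move=> p q /andP[/andP[a b] /andP[c e]]; apply: val_inj.
apply: injective_projections; apply/eqP; rewrite eq_le.
  by rewrite [X in X && _]c [X in _ && X]a.
by rewrite [X in X && _]b [X in _ && X]e.
Qed.

Fact bitime_le_trans : transitive bitime_le.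
Proof.
move=> q p r /andP[a b] /andP[c e].
by rewrite /bitime_le (le_trans c a) (le_trans b e).
Qed.

HB.instance Definition _ := Order.Le_isPOrder.Build ring_display bitime
  bitime_le_refl bitime_le_anti bitime_le_trans.

End Bitime.

(* [t] lies in [t_m, t_{m+1}), where t_{M+1} is infinite. *)
Definition in_stage (R : realType) (n : nat) (cp : 'I_n -> R) (m : 'I_n)
    (t : R) : bool :=
  (cp m <= t) && [forall l : 'I_n, (l == m.+1 :> nat) ==> (t < cp l)].

(* There are M = [nb_pred].+1 change points, numbered from 0.  The values of
   [theta] before the first one are irrelevant. *)
Record partition_seq (R : realType) (X : finType) := PartitionSeq {
  nb_pred : nat;
  chpt : 'I_nb_pred.+1 -> R;
  theta :> R -> {set {set X}};
  chpt_incr : forall m n : 'I_nb_pred.+1, (m < n)%N -> chpt m < chpt n;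
  theta_partition : forall t, chpt ord0 <= t -> partition (theta t) [set: X];
  theta_const : forall m t, in_stage chpt m t -> theta t = theta (chpt m)
}.

Section MCbiF.
Variables (R : realType) (X : finType) (th : partition_seq R X).
Local Notation M := (nb_pred th).+1.
Local Notation cp := (@chpt R X th).
Local Notation times := (bitime (cp ord0)).

(* The empty set belongs to every [powerset C] and is not removed. *)
Definition mcbif_simplices (s t : R) : {set {set X}} :=
  [set sg : {set X} | `[< exists2 r : R, s <= r <= t &
                exists2 C : {set X}, C \in th r & sg \in powerset C >]].

Fact mcbif_closed (s t : R) (sg ta : {set X}) :
  sg \in mcbif_simplices s t -> ta \subset sg -> ta != set0 ->
  ta \in mcbif_simplices s t.
Proof.
rewrite !inE => /asboolP[r str [C Cr]]; rewrite inE => sC ts _.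
apply/asboolP; exists r => //; exists C => //.
by rewrite inE (subset_trans ts).
Qed.

Definition mcbif_complex (p : times) : complex X :=
  Complex (@mcbif_closed (btstart p) (btend p)).

Fact mcbifS (p q : times) :
  (p <= q)%O -> mcbif_complex p \subset mcbif_complex q.
Proof.
move=> /andP[qp pq]; apply/subsetP => sg; rewrite !inE.
move=> /asboolP[r /andP[pr rp] Cr]; apply/asboolP; exists r => //.
by rewrite (le_trans qp pr) (le_trans rp pq).
Qed.

Definition mcbif : filtration times X := Filtration mcbifS.

(* The i-th cluster of theta(t_m) is given by [enum_val]. *)
Definition nerve_vertex : finType := {m : 'I_M & 'I_#|th (cp m)|}.

Definition vertex_cluster (v : nerve_vertex) : {set X} :=
  enum_val (tagged v).

Definition vertex_range (l m : 'I_M) : {set nerve_vertex} :=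
  [set v : nerve_vertex | (l <= tag v <= m)%N].

Definition nerve_simplices (s t : R) : {set {set nerve_vertex}} :=
  [set sg : {set nerve_vertex} | [exists l : 'I_M, exists m : 'I_M,
     [&& in_stage cp l s, in_stage cp m t, sg \subset vertex_range l m,
         sg != set0 & \bigcap_(v in sg) vertex_cluster v != set0]]].

Fact nerve_closed (s t : R) (sg ta : {set nerve_vertex}) :
  sg \in nerve_simplices s t -> ta \subset sg -> ta != set0 ->
  ta \in nerve_simplices s t.
Proof.
rewrite !inE => /existsP[l /existsP[m /and5P[ls mt sA _ /set0Pn[x xs]]]] ts ta0.
apply/existsP; exists l; apply/existsP; exists m.
rewrite ls mt ta0 (subset_trans ts sA) /=; apply/set0Pn; exists x.
apply/bigcapP => v vt; move/bigcapP: xs; apply; exact: (subsetP ts).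
Qed.

Definition nerve_complex (p : times) : complex nerve_vertex :=
  Complex (@nerve_closed (btstart p) (btend p)).

Lemma chpt_le (m n : 'I_M) : (m <= n)%N -> cp m <= cp n.
Proof.
rewrite leq_eqVlt => /orP[/eqP/val_inj -> //|mn].
exact/ltW/(chpt_incr mn).
Qed.

Lemma in_stage_mono (m n : 'I_M) (s t : R) :
  in_stage cp m s -> in_stage cp n t -> s <= t -> (m <= n)%N.
Proof.
move=> /andP[ms _] /andP[_ /forallP nt] st; rewrite leqNgt; apply/negP => nm.
have n1M : (n.+1 < M)%N by apply: leq_ltn_trans nm _; apply: ltn_ord.
have := nt (Ordinal n1M); rewrite eqxx /= => t_lt.
have := le_lt_trans (le_trans (@chpt_le (Ordinal n1M) m nm) (le_trans ms st)) t_lt.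
by rewrite ltxx.
Qed.

Lemma in_stage_ex (t : R) : cp ord0 <= t -> exists m, in_stage cp m t.
Proof.
move=> t0; case: (@arg_maxnP _ ord0 (fun m => cp m <= t) val t0) => m mt mmax.
exists m; rewrite /in_stage mt; apply/forallP => l; apply/implyP => /eqP lm.
by rewrite ltNge; apply/negP => /mmax; rewrite /= lm ltnn.
Qed.

Fact nerve_mcbifS (p q : times) :
  (p <= q)%O -> nerve_complex p \subset nerve_complex q.
Proof.
move=> /andP[qp pq]; apply/subsetP => sg; rewrite !inE.
move=> /existsP[l /existsP[m /and5P[ls mt sA sg0 ne]]].
have /andP[q0 qq] := valP q.
have [l' l's] := in_stage_ex q0.
have [m' m't] := in_stage_ex (le_trans q0 qq).
apply/existsP; exists l'; apply/existsP; exists m'.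
rewrite l's m't sg0 ne !andbT /=; apply: subset_trans sA _.
apply/subsetP => v; rewrite !inE => /andP[lv vm].
rewrite (leq_trans (in_stage_mono l's ls qp) lv).
exact: leq_trans vm (in_stage_mono mt m't pq).
Qed.

Definition nerve_mcbif : filtration times nerve_vertex :=
  Filtration nerve_mcbifS.

End MCbiF.

(* Main.v *)
Require Import Defs.
From HB Require Import structures.
From mathcomp Require Import all_boot all_order all_algebra.
From mathcomp Require Import boolp reals.

(** The two complexes at a bitime [p] are the two Dowker complexes of one relation:
    a point of X is incident to a cluster of a partition active in [p] when it
    belongs to that cluster ([mcbif_incident], [nerve_incident]).  A set of points
    is a simplex of the first when its points have a common incident cluster, and
    a set of clusters is a simplex of the second when its clusters have a common
    incident point.  The statement is thus Dowker duality, natural in the relation.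

    For the naturality, the two complexes are compared without any choice: both
    sit in a third complex, the join, on the disjoint union of points and clusters.
    Its simplices are the unions of a simplex on each side, one possibly empty, in
    which every point is incident to every cluster.  The join grows with the
    relation and the embeddings into it commute with inclusions
    ([push_homology_incl]), so it remains to see that each embedding induces an
    isomorphism in homology ([push_homology_bij]); the isomorphism of persistence
    modules is then the first embedding followed by the inverse of the second.

    For the points, consider the simplices of the join having a prescribed nonempty
    set of clusters.  Their point parts are all the sets of points incident to all
    these clusters, the empty set included, so they form a full simplex with its
    empty face, and adding one fixed such point contracts them.  The point depends
    on the set of clusters, so the cones do not fit into one homotopy, but they do
    up to terms with fewer clusters ([homotopy_defect_level]), and an induction on
    the number of clusters shows that the homology of the join relative to the
    complex of points vanishes ([relative_acyclic]).  The argument for the clusters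
    is the same, so it is made once, for a complex and a set A of its vertices. *)

Set Implicit Arguments.
Unset Strict Implicit.
Unset Printing Implicit Defensive.

Import Order.TTheory GRing.Theory Num.Theory.
Local Open Scope ring_scope.

(** * Chains and their supports *)

Section Chains.
Variables (F : fieldType) (V : finType).
Implicit Types (c d : chain F V) (s t : {set V}) (P Q : pred {set V}).

(** Working with supports rather than spans lets one describe a chain by
    conditions on its simplices beyond those of [chains]. *)
Definition supported P c := forall s, c s != 0 -> P s.

Lemma supported_elem P s : P s -> supported P (elem_chain F s).
Proof. by move=> Ps t; rewrite ffunE; case: (t =P s) => [->|_]; rewrite ?eqxx. Qed.

Lemma supported0 P : supported P 0.
Proof. by move=> s; rewrite ffunE eqxx. Qed.

Lemma supportedD P c d : supported P c -> supported P d -> supported P (c + d).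
Proof.
move=> cP dP s; rewrite ffunE; have [c0|/cP //] := eqVneq (c s) 0.
by rewrite c0 add0r => /dP.
Qed.

Lemma supportedZ P a c : supported P c -> supported P (a *: c).
Proof. by move=> cP s; rewrite ffunE mulf_eq0 negb_or => /andP[_ /cP]. Qed.

Lemma supportedB P c d : supported P c -> supported P d -> supported P (c - d).
Proof. by rewrite -scaleN1r => cP dP; apply/supportedD/supportedZ. Qed.

Lemma supported_sum P (I : Type) (r : seq I) (D : pred I) (f : I -> chain F V) :
  (forall i, D i -> supported P (f i)) -> supported P (\sum_(i <- r | D i) f i).
Proof.
by move=> fP; apply: big_ind => //; [apply: supported0 | apply: supportedD].
Qed.

Lemma supportedW P Q c : subpred P Q -> supported P c -> supported Q c.
Proof. by move=> PQ cP s /cP/PQ. Qed.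

Lemma chain_sum c : c = \sum_s c s *: elem_chain F s.
Proof.
apply/ffunP => t; rewrite sum_ffunE (bigD1 t) //= big1 ?addr0.
  by rewrite !ffunE eqxx [RHS]mulr1.
by move=> s st; rewrite !ffunE eq_sym (negPf st) [LHS]mulr0.
Qed.

Lemma chainsP (K : complex V) k c :
  reflect (supported (fun s => (s \in K) && (#|s| == k.+1)) c) (c \in chains F K k).
Proof.
apply: (iffP idP) => [|cK].
  rewrite /chains => /(@coord_span _ _ _ (in_tuple _)) ->.
  apply: supported_sum => i _; apply: supportedZ.
  have : tnth (in_tuple [seq elem_chain F s | s <- enum K & #|s| == k.+1]) i
     \in [seq elem_chain F s | s <- enum K & #|s| == k.+1] by apply: mem_tnth.
  rewrite (tnth_nth 0) /= => /mapP[s].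
  by rewrite mem_filter mem_enum andbC => sK ->; apply: supported_elem.
rewrite [c]chain_sum; apply: rpred_sum => s _.
have [->|/cK /andP[sK sk]] := eqVneq (c s) 0; first by rewrite scale0r rpred0.
by apply/rpredZ/memv_span/map_f; rewrite mem_filter mem_enum sk.
Qed.

Section Extension.
Variables (U : lmodType F) (g : {set V} -> U).

Definition lin_ext c : U := \sum_s c s *: g s.

Fact lin_ext_linear : linear lin_ext.
Proof.
move=> a c d; rewrite /lin_ext scaler_sumr -big_split /=.
by apply: eq_bigr => s _; rewrite !ffunE scalerDl scalerA.
Qed.

HB.instance Definition _ :=
  GRing.isLinear.Build F (chain F V) U _ lin_ext lin_ext_linear.

Lemma lin_ext_elem s : lin_ext (elem_chain F s) = g s.
Proof.
rewrite /lin_ext (bigD1 s) //= ffunE eqxx scale1r big1 ?addr0 // => t ts.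
by rewrite ffunE (negPf ts) scale0r.
Qed.

End Extension.

End Chains.

Lemma supported_linear (F : fieldType) (V W : finType) (P : pred {set V})
    (Q : pred {set W}) (f : {linear chain F V -> chain F W}) (c : chain F V) :
  (forall s, P s -> supported Q (f (elem_chain F s))) ->
  supported P c -> supported Q (f c).
Proof.
move=> fPQ cP; rewrite [c]chain_sum linear_sum; apply: supported_sum => s _.
have [->|/cP Ps] := eqVneq (c s) 0.
  by rewrite scale0r linear0; apply: supported0.
by rewrite linearZ; apply/supportedZ/fPQ.
Qed.

Lemma eq_linear (F : fieldType) (V : finType) (U : lmodType F)
    (f g : {linear chain F V -> U}) :
  (forall s, f (elem_chain F s) = g (elem_chain F s)) -> f =1 g.
Proof.
move=> fg c; rewrite [c]chain_sum !linear_sum; apply: eq_bigr => s _.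
by rewrite !linearZ fg.
Qed.

Lemma boundary_boundary (F : fieldType) (V : finType) (c : chain F V) :
  boundary_fun (boundary_fun c) = 0.
Proof.
rewrite {2}/boundary_fun linear_sum big1 // => s _.
by rewrite linearZ /= boundary_face_sum scaler0.
Qed.

(** Removing two vertices in either order gives opposite signs.  The same
    identity that makes the boundary square to zero makes coning anticommute
    with it. *)
Lemma vertex_pos_swap (F : fieldType) (V : finType) (s : {set V}) a v :
  a \in s -> v \in s -> a != v ->
  (-1) ^+ (vertex_pos s a + vertex_pos s v)%N =
  - (-1) ^+ (vertex_pos (s :\ a) v + vertex_pos (s :\ v) a)%N :> F.
Proof.
move=> as_ vs av; rewrite (vertex_pos_del v as_) (vertex_pos_del a vs).
rewrite -[RHS]mulN1r -exprS; have /orP[lt|lt] : (enum_rank a < enum_rank v)%N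
    || (enum_rank v < enum_rank a)%N.
- by rewrite -neq_ltn (inj_eq val_inj) (inj_eq enum_rank_inj).
- by rewrite lt ltnNge (ltnW lt) /= add0n add1n addnS addnC.
- by rewrite lt ltnNge (ltnW lt) /= add0n add1n addSn addnC.
Qed.

Lemma setDU1 (T : finType) (A s : {set T}) a : a \in A -> (a |: s) :\: A = s :\: A.
Proof.
move=> aA; rewrite setDUl (_ : [set a] :\: A = set0) ?set0U //.
by apply/eqP; rewrite setD_eq0 sub1set.
Qed.

(** * Cones with a varying apex *)

Section Cone.
Variables (F : fieldType) (W : finType) (L : complex W) (A : {set W}).
Implicit Types (s : {set W}) (c : chain F W).

(** The apex depends only on the part of [s] outside [A], so that it is shared
    by [s] and by every face of [s] that loses only vertices of [A]. *)
Definition is_apex s a :=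
  (a \in A) && [forall t : {set W}, (t \in L) && (t :\: A == s :\: A)
                                 ==> (a |: t \in L)].

Definition coneable := forall s, s \in L -> s :\: A != set0 -> exists a, is_apex s a.

(** The cone is cut off to zero inside [A], where there is nothing to contract,
    and degenerates to zero when the apex is already a vertex. *)
Definition elem_cone s : chain F W :=
  if s :\: A == set0 then 0 else
  if [pick a | is_apex s a] is Some a then
    if a \in s then 0 else (-1) ^+ vertex_pos (a |: s) a *: elem_chain F (a |: s)
  else 0.

Definition cone := lin_ext elem_cone.
HB.instance Definition _ := GRing.Linear.on cone.

Lemma cone_elem s : cone (elem_chain F s) = elem_cone s.
Proof. exact: lin_ext_elem. Qed.

(** The filtration of [L] by the number of vertices outside [A]; its zeroth step
    is the part of [L] lying inside [A]. *)
Definition level j m s := [&& s \in L, #|s| == j & (#|s :\: A| <= m)%N].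

Lemma level_face j m s v : level j.+1 m s -> v \in s -> s :\ v != set0 ->
  level j m (s :\ v).
Proof.
move=> /and3P[sL sj sm] vs s0; apply/and3P; split.
- exact: simplices_closed sL (subD1set _ _) s0.
- by rewrite -eqSS -(eqP sj) (cardsD1 v s) vs add1n.
- by apply: leq_trans sm; apply/subset_leq_card/setSD/subD1set.
Qed.

Lemma level_face_lt j m s v : level j.+1 m.+1 s -> v \in s -> v \notin A ->
  s :\ v != set0 -> level j m (s :\ v).
Proof.
move=> sl vs vA s0; have /and3P[tL tj _] := level_face sl vs s0.
apply/and3P; split => //; case/and3P: sl => _ _ sm; rewrite -ltnS.
apply: leq_trans sm; apply: proper_card; rewrite properE setSD ?subD1set //=.
by apply/subsetPn; exists v; rewrite !inE ?vA ?vs ?eqxx.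
Qed.

Lemma apex_in s a : is_apex s a -> s \in L -> a |: s \in L.
Proof. by move=> /andP[_ /forallP/(_ s)]; rewrite eqxx andbT => /implyP. Qed.

Lemma elem_cone_level j m s : level j m s -> supported (level j.+1 m) (elem_cone s).
Proof.
rewrite /elem_cone => /and3P[sL sj sm]; case: ifP => [_|_]; first exact: supported0.
case: pickP => [a ap|_]; last exact: supported0.
case: ifPn => as_; first exact: supported0.
apply/supportedZ/supported_elem/and3P; split.
- exact: apex_in.
- by rewrite cardsU1 as_ (eqP sj).
- by case/andP: ap => aA _; rewrite setDU1.
Qed.

Lemma cone_level j m c : supported (level j m) c ->
  supported (level j.+1 m) (cone c).
Proof.
apply: supported_linear => s sl; rewrite /= cone_elem.
exact: elem_cone_level.
Qed.

Lemma cone_supported0 c : supported (fun s => s :\: A == set0) c -> cone c = 0.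
Proof.
move=> c0; rewrite /cone /lin_ext big1 // => s _; have [->|/c0 s0] := eqVneq (c s) 0.
  by rewrite scale0r.
by rewrite /elem_cone s0 scaler0.
Qed.

Definition homotopy_defect c := c - boundary_fun (cone c) - cone (boundary_fun c).

Fact homotopy_defect_linear : linear homotopy_defect.
Proof.
move=> a c d; rewrite /homotopy_defect !(linearD, linearZ) /= ?(linearD, linearZ) /=.
by rewrite [X in X + _ = _]addrACA [LHS]addrACA.
Qed.

HB.instance Definition _ :=
  GRing.isLinear.Build F (chain F W) (chain F W) _ homotopy_defect homotopy_defect_linear.

(** Modulo faces with fewer vertices outside [A], the boundary only removes
    vertices of [A]; these do not change the apex, so the computation is the one
    for a cone with a fixed apex.  A vertex of [s] outside [A] remains in all
    these faces, hence no face is empty, and the usual exception of a cone in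
    degree zero does not occur. *)
Lemma homotopy_defect_level j m s : coneable -> level j.+1 m.+1 s -> s :\: A != set0 ->
  supported (level j.+1 m) (homotopy_defect (elem_chain F s)).
Proof.
move=> LA sl s0; have /and3P[sL sj sm] := sl; have [a0 a0P] := LA _ sL s0.
rewrite /homotopy_defect.
rewrite cone_elem boundary_elem.
have coneE t : t :\: A = s :\: A -> [pick a | is_apex t a] = [pick a | is_apex s a].
  by move=> ts; rewrite /is_apex ts.
have face0 v : v \in s -> v \in A -> s :\ v != set0.
  move=> vs vA; apply: contra_neq s0 => sv.
  by rewrite -(setD1K vs) sv setU0; apply/eqP; rewrite setD_eq0 sub1set.
have faceA v : v \in A -> (s :\ v) :\: A = s :\: A.
  move=> vA; apply/setP => w; rewrite !inE; case: eqP => [->|//].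
  by rewrite vA.
(* Faces opposite to a vertex outside [A] only contribute to the lower level. *)
have -> : cone (face_sum F s) =
     \sum_(v in s | (v \in A)) (-1) ^+ vertex_pos s v *: elem_cone (s :\ v)
   + \sum_(v in s | (v \notin A) && (s :\ v != set0))
         (-1) ^+ vertex_pos s v *: elem_cone (s :\ v).
  rewrite /face_sum linear_sum (bigID (mem A)) /=; congr (_ + _).
    apply: eq_big => [v|v _]; last by rewrite linearZ /= cone_elem.
    by case vs : (v \in s); case vA : (v \in A); rewrite ?andbF // face0.
  apply: eq_big => [v|v _]; last by rewrite linearZ /= cone_elem.
  by rewrite -andbA [(_ != _) && _]andbC.
rewrite opprD addrA; apply: supportedB; last first.
  apply: supported_sum => v /and3P[vs vA sv0]; apply: supportedZ.
  exact/elem_cone_level/(level_face_lt sl).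
have elem_coneE t : t :\: A = s :\: A -> elem_cone t =
   if [pick a | is_apex s a] is Some a then
    if a \in t then 0 else (-1) ^+ vertex_pos (a |: t) a *: elem_chain F (a |: t)
   else 0.
  by move=> ts; rewrite /elem_cone (coneE _ ts) ts (negPf s0).
under [X in _ - X]eq_bigr => v /andP[_ vA] do rewrite (elem_coneE _ (faceA _ vA)).
rewrite elem_coneE //; case: pickP => [a ap|/(_ a0)]; last by rewrite a0P.
have /andP[aA _] := ap.
have [as_|as_] := boolP (a \in s).
  (* The cone of [s] vanishes; the face opposite to the apex cones back to [s]. *)
  rewrite linear0 subr0 (bigD1 a) ?as_ //= !inE eqxx /= setD1K // scalerA -expr2.
  rewrite sqrr_sign scale1r big1 ?addr0 ?subrr; first exact: supported0.
  by move=> v /andP[_ va]; rewrite !inE eq_sym va as_ scaler0.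
(* In the boundary of the cone, the face opposite to the apex is [s].  Those
   opposite to the other vertices of [A] cancel against the cones of the faces
   of [s], and the remaining ones are of lower level. *)
rewrite linearZ /= boundary_elem /face_sum.
have aS : a \in a |: s by rewrite setU11.
have aSs : (a |: s) :\ a = s by rewrite setU1K.
have sn0 : s != set0 by apply: contra_neq s0 => ->; rewrite set0D.
rewrite (bigD1 a) /=; last by rewrite aS aSs.
rewrite aSs scalerDr scalerA -expr2 sqrr_sign scale1r opprD addrA subrr add0r.
rewrite (bigID (mem A)) /= scalerDr opprD -addrA [X in _ + X]addrC addrA.
apply: supportedB; last first.
  apply/supportedZ/supported_sum => v /andP[/andP[/andP[vS s0v] va] vA].
  apply/supportedZ/supported_elem; apply: (@level_face_lt j.+1) => //.
  apply/and3P; split; first exact: apex_in.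
    by rewrite cardsU1 as_ (eqP sj).
  by rewrite setDU1.
rewrite -opprD -scaleN1r; apply: supportedZ; rewrite scaler_sumr.
rewrite [X in X + _](_ : _ = \sum_(v in s | v \in A)
    (-1) ^+ (vertex_pos (a |: s) a + vertex_pos (a |: s) v)%N
      *: elem_chain F ((a |: s) :\ v)).
  rewrite -big_split /= big1; first exact: supported0.
  move=> v /andP[vs vA].
  have av : a != v by apply: contraNneq as_ => ->.
  rewrite !inE (negPf as_) andbF.
  have aSv : (a |: s) :\ v = a |: s :\ v.
    by apply/setP => w; rewrite !inE; case: (w =P a) => [->|]; rewrite ?av.
  rewrite scalerA -exprD vertex_pos_swap //; last by rewrite !inE vs orbT.
  by rewrite aSs aSv scaleNr addNr.
apply: eq_big => [v|v _]; last by rewrite scalerA exprD.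
rewrite !inE; have [->|va] := eqVneq v a; first by rewrite (negPf as_) andbF.
rewrite /=; case vs : (v \in s) => //=; case vA : (v \in A); rewrite ?andbF ?andbT //.
by apply/set0Pn; exists a; rewrite !inE eqxx eq_sym va.
Qed.

(** The pair formed by [L] and its part inside [A] has no homology.  Subtracting
    the boundary of the cone from a relative cycle removes its top level,
    because the other half of the homotopy vanishes on a boundary lying in [A];
    this is repeated until only level zero remains. *)
Lemma relative_acyclic k c : coneable -> c \in chains F L k ->
  supported (fun s => s :\: A == set0) (boundary_fun c) ->
  exists2 e, e \in chains F L k.+1 &
   supported (fun s => [&& s \in L, #|s| == k.+1 & s :\: A == set0])
     (c - boundary_fun e).
Proof.
move=> LA cL bc; have [m cm] : exists m, supported (level k.+1 m) c.
  exists #|W|; move: cL => /chainsP; apply: supportedW => s /andP[sL sk].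
  by rewrite /level sL sk max_card.
elim: m c cm bc {cL} => [|m IHm] c cm bc.
  exists 0; first exact: rpred0.
  by rewrite linear0 subr0; apply: supportedW cm => s; rewrite /level leqn0 cards_eq0.
have ec : cone c \in chains F L k.+1.
  apply/chainsP; apply: supportedW (cone_level cm) => s.
  by case/and3P => sL sk _; rewrite sL sk.
have step : supported (level k.+1 m) (c - boundary_fun (cone c)).
  rewrite -[X in supported _ X]subr0 -(cone_supported0 bc).
  apply: (supported_linear (f := homotopy_defect) _ cm) => s sl /=.
  have [s0|] := eqVneq (s :\: A) set0; last exact: homotopy_defect_level.
  rewrite /homotopy_defect !cone_supported0; first last.
  - by apply: supported_elem; rewrite s0.
  - rewrite boundary_elem; apply: supported_sum => v _.
    apply/supportedZ/supported_elem; rewrite -subset0 -s0 setSD //.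
    exact: subD1set.
  rewrite linear0 !subr0; apply: supported_elem.
  by case/and3P: sl => sL sk _; rewrite /level sL sk s0 cards0.
have [|e eL He] := IHm _ step.
  rewrite linearB /=; apply: supportedB => //.
  rewrite boundary_boundary; exact: supported0.
exists (cone c + e); first by rewrite rpredD.
by rewrite linearD /= opprD addrA.
Qed.

End Cone.

(** * Pushing homology forward along a full embedding *)

(** Orientations come from the enumeration order of the vertices: for such maps,
    the map induced on chains carries no signs. *)
Definition rank_mono (X W : finType) (i : X -> W) :=
  forall x y, (enum_rank (i x) < enum_rank (i y))%N = (enum_rank x < enum_rank y)%N.

Lemma rank_mono_inj (X W : finType) (i : X -> W) : rank_mono i -> injective i.
Proof.
move=> imono x y ixy; apply: enum_rank_inj; apply/val_inj/eqP.
by rewrite eqn_leq leqNgt -imono ixy ltnn leqNgt -imono ixy ltnn.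
Qed.

Section Push.
Variables (F : fieldType) (X W : finType) (i : X -> W).
Hypothesis imono : rank_mono i.
Implicit Types (s : {set X}) (c : chain F X).

Let iinj : injective i := rank_mono_inj imono.

Definition push := lin_ext (fun s => elem_chain F (i @: s)).
HB.instance Definition _ := GRing.Linear.on push.

Lemma push_elem s : push (elem_chain F s) = elem_chain F (i @: s).
Proof. exact: lin_ext_elem. Qed.

Lemma pushE c s : push c (i @: s) = c s.
Proof.
rewrite /push /lin_ext sum_ffunE (bigD1 s) //= big1 => [|t ts].
  by rewrite addr0 !ffunE eqxx [LHS]mulr1.
by rewrite !ffunE (inj_eq (imset_inj iinj)) eq_sym (negPf ts) [LHS]mulr0.
Qed.

Lemma push_inj : injective push.
Proof. by move=> c d cd; apply/ffunP => s; rewrite -!pushE cd. Qed.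

Lemma push_face_sum s : push (face_sum F s) = face_sum F (i @: s).
Proof.
have iD v : i @: s :\ i v = i @: (s :\ v).
  apply/setP => w; apply/setD1P/imsetP => [[wv /imsetP[x xs wx]]|[x]].
    by exists x; rewrite // !inE xs andbT; apply: contra_neq wv; rewrite wx => ->.
  by rewrite !inE => /andP[xv xs] ->; rewrite (inj_eq iinj) imset_f.
rewrite /face_sum linear_sum big_imset_cond /=; last by move=> ? ? _ _ /iinj.
apply: eq_big => [v|v _]; first by rewrite iD imset_eq0.
rewrite linearZ /= push_elem iD; congr (_ ^+ _ *: _).
rewrite /vertex_pos -(card_imset _ iinj); apply: eq_card => w.
rewrite !inE; apply/imsetP/andP => [[x]|[/imsetP[x xs ->]]].
  by rewrite inE => /andP[xs xv] ->; rewrite imset_f // imono.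
by rewrite imono => xv; exists x; rewrite // inE xs.
Qed.

Lemma push_boundary c : push (boundary_fun c) = boundary_fun (push c).
Proof.
have E : push \o @boundary_fun F X =1 @boundary_fun F W \o push.
  by apply: eq_linear => s /=; rewrite push_elem !boundary_elem push_face_sum.
exact: E.
Qed.

End Push.

(** [K] is the full subcomplex of [L] on the image of [i].  The empty set is
    exempted since homology does not see whether it is a simplex. *)
Definition full_embedding (X W : finType) (i : X -> W) (K : complex X)
    (L : complex W) :=
  rank_mono i /\ forall s : {set X}, s != set0 -> (s \in K) = (i @: s \in L).

Section PushHomology.
Variables (F : fieldType) (X W : finType) (i : X -> W).
Variables (K : complex X) (L : complex W) (k : nat).
Hypothesis iKL : full_embedding i K L.
Implicit Types c : chain F X.

Let imono : rank_mono i := proj1 iKL.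
Let KL := proj2 iKL.
Let iinj : injective i := rank_mono_inj imono.
Local Notation push := (push i).

Lemma push_chains j c : (push c \in chains F L j) = (c \in chains F K j).
Proof.
apply/chainsP/chainsP => cK s.
  rewrite -(pushE imono) => /cK; rewrite card_imset //.
  case/andP => sL sj; rewrite sj andbT KL // -card_gt0 (eqP sj) //.
move: s; apply: supported_linear cK => s /andP[sK sj].
rewrite /= push_elem; apply: supported_elem; rewrite card_imset // sj andbT -KL //.
by rewrite -card_gt0 (eqP sj).
Qed.

Lemma push_cycles c : (push c \in cycles F L k) = (c \in cycles F K k).
Proof.
rewrite !memv_cap push_chains !memv_ker !lfunE /= -(push_boundary imono).
by rewrite -(inj_eq (push_inj imono)) linear0.
Qed.

Lemma push_boundaries c : c \in boundaries F K k -> push c \in boundaries F L k.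
Proof.
case/memv_imgP => e eK ->; apply/memv_imgP; exists (push e).
  by rewrite push_chains.
by rewrite !lfunE /= (push_boundary imono).
Qed.

Definition push_cycle (z : subvs_of (cycles F K k)) : subvs_of (cycles F L k) :=
  vsproj (cycles F L k) (push (vsval z)).

Lemma val_push_cycle z : vsval (push_cycle z) = push (vsval z).
Proof. by rewrite vsprojK // push_cycles subvsP. Qed.

(** The embedding is an argument so that the linear structure below can be
    inferred from the map. *)
Definition push_homology (_ : full_embedding i K L) (x : homology F K k) :
    homology F L k :=
  class_of _ (push_cycle (quot_repr x)).

Lemma homology_eqP (Y : finType) (J : complex Y) (z z' : subvs_of (cycles F J k)) :
  reflect (class_of (boundaries_in_cycles F J k) z = class_of _ z')
          (vsval z - vsval z' \in boundaries F J k).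
Proof.
have -> : (vsval z - vsval z' \in boundaries F J k) =
          (z - z' \in boundaries_in_cycles F J k).
  by rewrite -memv_preim lfunE /=.
exact: class_ofP.
Qed.

Lemma push_homology_class z :
  push_homology iKL (class_of _ z) = class_of _ (push_cycle z).
Proof.
apply/homology_eqP; rewrite !val_push_cycle -linearB; apply: push_boundaries.
by apply/homology_eqP; rewrite quot_reprK.
Qed.

Fact push_homology_linear : linear (push_homology iKL).
Proof.
move=> a x y; rewrite -[x]quot_reprK -[y]quot_reprK -linearP.
by rewrite !push_homology_class /push_cycle !linearP.
Qed.

HB.instance Definition _ :=
  GRing.isLinear.Build F (homology F K k) (homology F L k) _ (push_homology iKL)
    push_homology_linear.

Let A : {set W} := i @: [set: X].

Lemma push_surj j (c : chain F W) :
  supported (fun s : {set W} => [&& s \in L, #|s| == j.+1 & s :\: A == set0]) c ->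
  exists2 z, z \in chains F K j & c = push z.
Proof.
move=> cA; pose z : chain F X := [ffun s : {set X} => c (i @: s)].
have cz : c = push z.
  apply/ffunP => t; have [ti|tni] := boolP (t \subset A).
    have -> : t = i @: (i @^-1: t).
      apply/setP => w; apply/idP/imsetP => [wt|[x]]; last by rewrite inE => xt ->.
      by have /imsetP[x _ wx] := subsetP ti w wt; exists x; rewrite // inE -wx.
    by rewrite (pushE imono) ffunE.
  have [->|/cA] := eqVneq (c t) 0; last by rewrite setD_eq0 (negPf tni) !andbF.
  rewrite /push /lin_ext sum_ffunE big1 // => s _; rewrite !ffunE.
  case: eqP => [ts|_]; last by rewrite [LHS]mulr0.
  by move: tni; rewrite ts imsetS ?subsetT.
exists z => //; rewrite -push_chains -cz; apply/chainsP.
by apply: supportedW cA => s /and3P[sL sj _]; rewrite sL sj.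
Qed.

(** By [relative_acyclic], a cycle of [L] is homologous to one in the image of
    [i], and a chain of [L] that bounds a cycle from [K] can be moved into that
    image. *)
Lemma push_homology_bij : coneable L A -> bijective (push_homology iKL).
Proof.
move=> LA; have supp_push c : supported (fun s : {set W} => s :\: A == set0) (push c).
  apply: (@supported_linear _ _ _ predT) => // s _ /=; rewrite push_elem.
  by apply: supported_elem; rewrite setD_eq0 imsetS ?subsetT.
have injf : injective (push_homology iKL).
  move=> x y; rewrite -[x]quot_reprK -[y]quot_reprK !push_homology_class.
  move/homology_eqP; rewrite !val_push_cycle -linearB => /memv_imgP[c cL].
  rewrite lfunE /= => pc; apply/homology_eqP.
  have [|e eL He] := relative_acyclic LA cL; first by rewrite -pc.
  have [z zK ez] := push_surj He.
  apply/memv_imgP; exists z; rewrite ?lfunE //=; apply: (push_inj imono).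
  by rewrite (push_boundary imono) -ez [RHS]linearB /= -pc boundary_boundary subr0.
have surj y : exists x, push_homology iKL x = y.
  rewrite -[y]quot_reprK; move: (quot_repr y) => w.
  have := subvsP w; rewrite memv_cap memv_ker lfunE /= => /andP[wL /eqP bw].
  have [|e eL He] := relative_acyclic LA wL; first by rewrite bw; apply: supported0.
  have [z zK ez] := push_surj He.
  have zc : z \in cycles F K k.
    rewrite -push_cycles -ez memv_cap memv_ker lfunE /= linearB /= bw.
    rewrite boundary_boundary subr0 eqxx andbT rpredB //.
    apply: (subvP (capvSl _ _)); apply: (subvP (boundaries_sub _ _ _)).
    by apply/memv_imgP; exists e; rewrite ?lfunE.
  exists (class_of _ (vsproj _ z)); rewrite push_homology_class.
  apply/homology_eqP; rewrite val_push_cycle vsprojK // -ez.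
  rewrite addrAC subrr add0r rpredN.
  by apply/memv_imgP; exists e; rewrite ?lfunE.
pose g y := sval (cid (surj y)).
have gK : cancel g (push_homology iKL) by move=> y; rewrite /g; case: cid.
by exists g => // x; apply: injf; rewrite gK.
Qed.

End PushHomology.

(** * The join complex of a relation *)

Lemma enum_sum (X V : finType) :
  enum {: X + V} = map inl (enum X) ++ map inr (enum V).
Proof. by rewrite !enumT [in LHS]unlock. Qed.

Lemma val_enum_rank (T : finType) (x : T) : enum_rank x = index x (enum T) :> nat.
Proof.
by rewrite -[x in RHS](nth_enum_rank x) index_uniq ?enum_uniq // -cardE ltn_ord.
Qed.

Lemma inl_rank_mono (X V : finType) : rank_mono (@inl X V).
Proof.
have E (x : X) : enum_rank (inl x : X + V) = enum_rank x :> nat.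
  rewrite !val_enum_rank enum_sum index_cat mem_map ?mem_enum; last exact: inl_inj.
  by rewrite index_map //; apply: inl_inj.
by move=> x y; rewrite !E.
Qed.

Lemma inr_rank_mono (X V : finType) : rank_mono (@inr X V).
Proof.
have E (v : V) : enum_rank (inr v : X + V) = (#|X| + enum_rank v)%N :> nat.
  rewrite !val_enum_rank enum_sum index_cat index_map; last exact: inr_inj.
  by rewrite size_map -cardE; case: ifP => // /mapP[].
by move=> x y; rewrite !E ltn_add2l.
Qed.

Section Join.
Variables (X V : finType) (r : X -> V -> bool).
Implicit Types s t : {set X + V}.

(** A simplex is a disjoint union of a simplex of each of the two complexes
    attached to the relation [r], either of them possibly empty, such that all
    its mixed pairs are related.  Up to homotopy this is a double mapping cylinder
    between the two complexes. *)
Definition join_simplices : {set {set X + V}} :=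
  [set s : {set X + V} |
    [&& [exists v, forall x, (inl x \in s) ==> r x v],
        [exists x, forall v, (inr v \in s) ==> r x v]
      & [forall x, forall v, (inl x \in s) && (inr v \in s) ==> r x v]]].

Lemma joinP s :
  reflect [/\ exists v, forall x, inl x \in s -> r x v,
              exists x, forall v, inr v \in s -> r x v
            & forall x v, inl x \in s -> inr v \in s -> r x v]
    (s \in join_simplices).
Proof.
rewrite inE; apply: (iffP and3P) =>
  [[/existsP[v /forallP vP] /existsP[x /forallP xP] /forallP a]|[[v vP] [x xP] a]].
  split; [exists v|exists x|] => [y|y|y w ys ws]; [exact/implyP|exact/implyP|].
  by have /forallP/(_ w)/implyP := a y; apply; rewrite ys.
split; [apply/existsP; exists v|apply/existsP; exists x|].
- by apply/forallP => y; apply/implyP/vP.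
- by apply/forallP => y; apply/implyP/xP.
- by apply/forallP => y; apply/forallP => w; apply/implyP => /andP[]; apply: a.
Qed.

Fact join_closed s t :
  s \in join_simplices -> t \subset s -> t != set0 -> t \in join_simplices.
Proof.
move=> /joinP[[v vP] [x xP] a] /subsetP ts _; apply/joinP; split.
- by exists v => y /ts; apply: vP.
- by exists x => y /ts; apply: xP.
- by move=> y w /ts ys /ts; apply: a.
Qed.

Definition join_complex := Complex join_closed.

(** A simplex with a vertex in [V] can be coned to any [x] related to all its
    vertices in [V]; the choice depends on these vertices only. *)
Lemma inl_coneable : coneable join_complex (inl @: [set: X]).
Proof.
have inlA y : inl y \in (inl @: [set: X] : {set X + V}) by apply: imset_f.
have inrA v : (inr v \in (inl @: [set: X] : {set X + V})) = false.
  by apply/negP => /imsetP[].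
move=> s /joinP[_ [x xP] _] s0; exists (inl x); rewrite /is_apex inlA.
apply/forallP => t; apply/implyP => /andP[/joinP[tv tx ta] /eqP ts].
have rtx v : inr v \in t -> r x v.
  move=> vt; apply: xP; have : inr v \in t :\: inl @: [set: X] by rewrite inE inrA.
  by rewrite ts inE => /andP[].
have [v vt] : exists v, inr v \in t.
  move: s0; rewrite -ts => /set0Pn[[y|v]]; rewrite inE ?inlA //.
  by case/andP => _ ?; exists v.
apply/joinP; split.
- exists v => y; rewrite !inE => /orP[/eqP[->]|yt]; [exact: rtx|exact: ta].
- by exists x => w; rewrite !inE => /orP[//|]; apply: rtx.
- move=> y w; rewrite !inE => /orP[/eqP[->]|yt] /orP[//|wt]; [exact: rtx|exact: ta].
Qed.

Lemma inr_coneable : coneable join_complex (inr @: [set: V]).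
Proof.
have inrA v : inr v \in (inr @: [set: V] : {set X + V}) by apply: imset_f.
have inlA x : (inl x \in (inr @: [set: V] : {set X + V})) = false.
  by apply/negP => /imsetP[].
move=> s /joinP[[v vP] _ _] s0; exists (inr v); rewrite /is_apex inrA.
apply/forallP => t; apply/implyP => /andP[/joinP[tv tx ta] /eqP ts].
have rtv x : inl x \in t -> r x v.
  move=> xt; apply: vP; have : inl x \in t :\: inr @: [set: V] by rewrite inE inlA.
  by rewrite ts inE => /andP[].
have [x xt] : exists x, inl x \in t.
  move: s0; rewrite -ts => /set0Pn[[x|w]]; rewrite inE ?inrA //.
  by case/andP => _ ?; exists x.
apply/joinP; split.
- by exists v => y; rewrite !inE => /orP[//|]; apply: rtv.
- exists x => w; rewrite !inE => /orP[/eqP[->]|wt]; [exact: rtv|exact: ta].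
- move=> y w; rewrite !inE => /orP[//|yt] /orP[/eqP[->]|wt]; [exact: rtv|exact: ta].
Qed.

Lemma inl_join (s : {set X}) : s != set0 ->
  (inl @: s \in join_complex) = [exists v, [forall x in s, r x v]].
Proof.
move=> /set0Pn[x0 x0s]; apply/joinP/existsP => [[[v vP] _ _]|[v /forall_inP vP]].
  by exists v; apply/forall_inP => x xs; apply/vP/imset_f.
split; [exists v | exists x0 | ].
- by move=> x /imsetP[y ys [->]]; apply: vP.
- by move=> w /imsetP[].
- by move=> x w _ /imsetP[].
Qed.

Lemma inr_join (t : {set V}) : t != set0 ->
  (inr @: t \in join_complex) = [exists x, [forall v in t, r x v]].
Proof.
move=> /set0Pn[v0 v0t]; apply/joinP/existsP => [[_ [x xP] _]|[x /forall_inP xP]].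
  by exists x; apply/forall_inP => v vt; apply/xP/imset_f.
split; [exists v0 | exists x | ].
- by move=> y /imsetP[].
- by move=> w /imsetP[y ys [->]]; apply: xP.
- by move=> y w /imsetP[].
Qed.

End Join.

Lemma joinS (X V : finType) (r r' : X -> V -> bool) :
  (forall x v, r x v -> r' x v) -> join_complex r \subset join_complex r'.
Proof.
move=> rr; apply/subsetP => s /joinP[[v vP] [x xP] a]; apply/joinP; split.
- by exists v => y /vP/rr.
- by exists x => y /xP/rr.
- by move=> y w ys /(a _ _ ys)/rr.
Qed.

(** Both composites are the same map on cycles: inclusions do nothing there. *)
Lemma push_homology_incl (F : fieldType) (X W : finType) (i : X -> W)
    (K K' : complex X) (L L' : complex W) (k : nat)
    (iKL : full_embedding i K L) (iKL' : full_embedding i K' L')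
    (KK : K \subset K') (LL : L \subset L') (x : homology F K k) :
  push_homology iKL' (homology_map KK x) = homology_map LL (push_homology iKL x).
Proof.
rewrite -[x]quot_reprK homology_map_class !push_homology_class homology_map_class.
congr (class_of _ _); apply: val_inj.
by rewrite /= (val_push_cycle iKL') !val_cycles_incl (val_push_cycle iKL).
Qed.

(** Dividing by an isomorphism keeps linearity; this composes the two legs of
    the zigzag through the join. *)
Lemma linear_div (F : fieldType) (U V W : lmodType F) (f : {linear U -> W})
    (g : {linear V -> W}) : bijective f -> bijective g ->
  exists h : {linear U -> V}, bijective h /\ forall u, g (h u) = f u.
Proof.
move=> bf [g' gK g'K].
have lin : linear (g' \o f).
  by move=> a u v; apply: (can_inj gK); rewrite /= g'K !linearP /= !g'K.
pose h : {linear U -> V} :=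
  HB.pack (g' \o f) (GRing.isLinear.Build F U V _ _ lin).
exists h; split => [|u /=].
  by apply: bij_comp => //; exists g.
by rewrite g'K.
Qed.

(** Dowker duality for a monotone family of relations.  Both complexes embed in
    the join of the relation, each embedding induces an isomorphism by coning
    the rest of the join towards it, and all the maps involved commute with the
    inclusions. *)
Theorem dowker_persmod_iso (F : fieldType) (d : Order.disp_t) (P : porderType d)
    (X V : finType) (K : filtration P X) (N : filtration P V)
    (r : P -> X -> V -> bool) (k : nat) :
  (forall p q, (p <= q)%O -> forall x v, r p x v -> r q x v) ->
  (forall p (s : {set X}), s != set0 ->
     (s \in K p) = [exists v, [forall x in s, r p x v]]) ->
  (forall p (t : {set V}), t != set0 ->
     (t \in N p) = [exists x, [forall v in t, r p x v]]) ->
  persmod_iso (homology_persmod F K k) (homology_persmod F N k).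
Proof.
move=> rS Kr Nr.
have KJ p : full_embedding inl (K p) (join_complex (r p)).
  by split=> [|s s0]; [apply: inl_rank_mono | rewrite inl_join ?Kr].
have NJ p : full_embedding inr (N p) (join_complex (r p)).
  by split=> [|t t0]; [apply: inr_rank_mono | rewrite inr_join ?Nr].
pose f p : {linear homology F (K p) k -> _} := push_homology (KJ p).
pose g p : {linear homology F (N p) k -> _} := push_homology (NJ p).
have bf p : bijective (f p) by apply/push_homology_bij/inl_coneable.
have bg p : bijective (g p) by apply/push_homology_bij/inr_coneable.
pose h p := cid (linear_div (bf p) (bg p)).
exists (fun p => sval (h p)); split=> [p | p q pq x]; first by case: (svalP (h p)).
apply: (bij_inj (bg q)); case: (svalP (h q)) => _ /= ->; rewrite /f /g.
have JS := joinS (rS _ _ pq).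
rewrite (push_homology_incl (KJ p) (KJ q) _ JS) (push_homology_incl (NJ p) (NJ q) _ JS).
by case: (svalP (h p)) => _ /= ->.
Qed.

(** * The incidence relation of a sequence of partitions *)

Section Stages.
Variables (R : realType) (X : finType) (th : partition_seq R X).
Local Notation cp := (@chpt R X th).
Implicit Types p : bitime (cp ord0).

(** Restricting to the vertices whose change point is active in [p] makes the
    two complexes at [p] the two Dowker complexes of this relation. *)
Definition incident p (x : X) (v : nerve_vertex th) : bool :=
  [exists l, exists m, [&& in_stage cp l (btstart p), in_stage cp m (btend p)
                         & (l <= tag v <= m)%N]] && (x \in vertex_cluster v).

Lemma in_stage_inj m n t : in_stage cp m t -> in_stage cp n t -> m = n.
Proof.
move=> mt nt; apply/val_inj/eqP; rewrite eqn_leq.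
by rewrite (in_stage_mono mt nt (lexx t)) (in_stage_mono nt mt (lexx t)).
Qed.

Lemma in_stage_chpt m : in_stage cp m (cp m).
Proof.
rewrite /in_stage lexx; apply/forallP => l; apply/implyP => /eqP lm.
by apply: chpt_incr; rewrite lm.
Qed.

(** The stages met between the times [s] and [t] are exactly those between
    the stages of [s] and [t]: the first is met at [s], and any later one at its
    change point. *)
Lemma stage_hit l m n s t : in_stage cp l s -> in_stage cp m t -> s <= t ->
  reflect (exists2 r, s <= r <= t & in_stage cp n r) (l <= n <= m)%N.
Proof.
move=> ls mt st; apply: (iffP andP) => [[ln nm]|[r /andP[sr rt] nr]]; last first.
  by split; [apply: in_stage_mono ls nr sr | apply: in_stage_mono nr mt rt].
have [nl|] := eqVneq n l; first by exists s; rewrite ?lexx ?nl.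
rewrite -(inj_eq val_inj) eq_sym => nl.
have l_n : (l < n)%N by rewrite ltn_neqAle nl.
exists (cp n); last exact: in_stage_chpt.
have l1M : (l.+1 < (nb_pred th).+1)%N := leq_ltn_trans l_n (ltn_ord n).
have mct : cp m <= t by case/andP: mt.
rewrite (le_trans (chpt_le nm) mct) andbT; apply: ltW.
case/andP: ls => _ /forallP/(_ (Ordinal l1M)); rewrite eqxx /= => sl.
by apply: lt_le_trans sl (@chpt_le _ _ _ (Ordinal l1M) n l_n).
Qed.

Lemma mcbif_incident p (s : {set X}) : s != set0 ->
  (s \in mcbif th p) = [exists v, [forall x in s, incident p x v]].
Proof.
move=> /set0Pn[x0 x0s]; have /andP[p0 pst] := valP p.
have [l ls] := in_stage_ex p0; have [m mt] := in_stage_ex (le_trans p0 pst).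
rewrite inE; apply/asboolP/existsP => [[r /andP[sr rt] [C Cr sC]]|[v /forall_inP vP]].
  have [n nr] := in_stage_ex (le_trans p0 sr).
  move: Cr; rewrite (theta_const nr) => Cn.
  pose v : nerve_vertex th := Tagged (fun m => 'I_#|th (cp m)|) (enum_rank_in Cn C).
  exists v; apply/forall_inP => x xs; apply/andP; split.
    apply/existsP; exists l; apply/existsP; exists m; apply/and3P; split=> //.
    by apply/(stage_hit _ ls mt pst); exists r; rewrite // sr.
  rewrite /vertex_cluster /= enum_rankK_in //.
  by move: sC; rewrite inE => /subsetP; apply.
have /andP[/existsP[l' /existsP[m' /and3P[ls' mt' lvm]]] _] := vP _ x0s.
have [r sr vr] := stage_hit _ ls' mt' pst lvm.
exists r => //; exists (vertex_cluster v).
  by rewrite (theta_const vr) /vertex_cluster; apply: enum_valP.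
by rewrite inE; apply/subsetP => x /vP/andP[].
Qed.

Lemma nerve_incident p (t : {set nerve_vertex th}) : t != set0 ->
  (t \in nerve_mcbif th p) = [exists x, [forall v in t, incident p x v]].
Proof.
move=> t0; rewrite inE; apply/existsP/existsP => [[l /existsP[m]]|[x /forall_inP xP]].
  case/and5P => ls mt /subsetP tA _ /set0Pn[x /bigcapP xt].
  exists x; apply/forall_inP => v vt; rewrite /incident xt // andbT.
  apply/existsP; exists l; apply/existsP; exists m; rewrite ls mt.
  by have := tA _ vt; rewrite inE.
have /set0Pn[v0 v0t] := t0.
have /andP[/existsP[l /existsP[m /and3P[ls mt _]]] _] := xP _ v0t.
exists l; apply/existsP; exists m; rewrite ls mt t0 /=; apply/andP; split.
  apply/subsetP => v /xP/andP[/existsP[l' /existsP[m' /and3P[ls' mt' lvm]]] _].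
  by rewrite inE (in_stage_inj ls ls') (in_stage_inj mt mt').
by apply/set0Pn; exists x; apply/bigcapP => v /xP/andP[].
Qed.

(** The singleton of a vertex is a simplex of the nerve exactly when the vertex
    is active, so monotonicity can be read off the filtration of the nerve. *)
Lemma incidentS p q : (p <= q)%O -> forall x v, incident p x v -> incident q x v.
Proof.
move=> pq x v xv; have : [set v] \in nerve_mcbif th p.
  rewrite nerve_incident; last by apply/set0Pn; exists v; rewrite inE.
  by apply/existsP; exists x; apply/forall_inP => w; rewrite inE => /eqP ->.
move/(subsetP (filS (nerve_mcbif th) pq)).
rewrite nerve_incident; last by apply/set0Pn; exists v; rewrite inE.
case/existsP => y /forall_inP/(_ v (set11 v)) /andP[vq _].
by case/andP: xv => _ xv; rewrite /incident vq.
Qed.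

End Stages.

Theorem proposition34 (F : fieldType) (R : realType) (X : finType)
    (th : partition_seq R X) (k : nat) :
  persmod_iso (homology_persmod F (mcbif th) k)
              (homology_persmod F (nerve_mcbif th) k).
Proof.
apply: (dowker_persmod_iso F k (@incidentS _ _ th)).
  exact: mcbif_incident.
exact: nerve_incident.
Qed.
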